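(* Every consistent atomic RCC8 network over $\{\mathbf{EC},\mathbf{DC},\mathbf{TPP},\mathbf{TPP}^{-1},\mathbf{NTPP},\mathbf{NTPP}^{-1}\}$ has a convex solution in $\mathbb{R}^4$.
   Context: A region in $\mathbb{R}^n$ ($n\geq 1$) is a nonempty regular closed subset $X$, i.e. $X=\mathrm{cl}(\mathrm{int}(X))$; write $i(X)$ for the interior. The eight RCC8 base relations between regions $a,b$ (jointly exhaustive and pairwise disjoint; $\subset$ denotes proper inclusion) are: $a\,\mathbf{EQ}\,b$: $a=b$; $a\,\mathbf{DC}\,b$: $a\cap b=\emptyset$; $a\,\mathbf{EC}\,b$: $a\cap b\neq\emptyset$ and $i(a)\cap i(b)=\emptyset$; $a\,\mathbf{PO}\,b$: $i(a)\cap i(b)\neq\emptyset$, $a\not\subseteq b$, $b\not\subseteq a$; $a\,\mathbf{TPP}\,b$: $a\subset b$ and $a\not\subset i(b)$; $a\,\mathbf{NTPP}\,b$: $a\subset i(b)$; and the converses $\mathbf{TPP}^{-1}$, $\mathbf{NTPP}^{-1}$ of the last two. Let $V$ be a finite set of variables. An RCC8 constraint is an expression $u\,R\,v$ with $u,v\in V$ and $R$ a nonempty set of base relations; an RCC8 network is a set of such constraints. It is atomic if for every pair of distinct variables $u,v$ it contains a constraint $u\,R\,v$ or $v\,R\,u$ with $R$ a singleton. It is a network over a set $\mathcal{R}$ of base relations if every constraint $u\,R\,v$ in it has $R\subseteq\mathcal{R}$. An $n$-dimensional solution (solution in $\mathbb{R}^n$) of a network is a map $\mathcal{S}$ from $V$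 to regions of $\mathbb{R}^n$ such that for each constraint $u\,R\,v$ the base relation holding between $\mathcal{S}(u)$ and $\mathcal{S}(v)$ belongs to $R$. A network is consistent if it has a solution in $\mathbb{R}^n$ for some $n\geq 1$ (the regions need not be convex or connected). A solution is convex if every $\mathcal{S}(v)$ is a convex set. *)

(* Defs.v *)
(* R^n is 'rV[R]_n for R : realType, with its product (= Euclidean) topology. *)
From mathcomp Require Import all_boot all_order all_algebra.
From mathcomp Require Import all_classical all_reals all_analysis.

Set Implicit Arguments.
Unset Strict Implicit.
Unset Printing Implicit Defensive.

Import numFieldNormedType.Exports.

Local Open Scope classical_set_scope.

Definition region (T : topologicalType) (X : set T) : Prop :=
  X !=set0 /\ regclosed X.

Inductive rcc8 : Type := EQ | DC | EC | PO | TPP | NTPP | TPPi | NTPPi.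

Section Relations.
Variable T : topologicalType.
Implicit Types a b : set T.

(* In rel_TPP and rel_NTPP the inclusions are proper, i.e. [`<`]; in particular
   the whole space is not a nontangential proper part of itself. *)
Definition rel_TPP a b : Prop := a `<` b /\ ~ (a `<` b°).
Definition rel_NTPP a b : Prop := a `<` b°.

Definition rcc8_holds (r : rcc8) a b : Prop :=
  match r with
  | EQ => a = b
  | DC => a `&` b = set0
  | EC => a `&` b !=set0 /\ a° `&` b° = set0
  | PO => [/\ a° `&` b° !=set0, ~ (a `<=` b) & ~ (b `<=` a)]
  | TPP => rel_TPP a b
  | NTPP => rel_NTPP a b
  | TPPi => rel_TPP b a
  | NTPPi => rel_NTPP b a
  end.

End Relations.

Record constraint (V : Type) := Constraint {
  lhs : V;
  rels : set rcc8;
  rhs : V;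
  rels_neq0 : rels !=set0
}.

Definition network (V : Type) := set (constraint V).

(* The constraint c is u {r} v for some base relation r. *)
Definition is_singleton_constraint (V : Type) (c : constraint V) (u v : V) :
    Prop :=
  [/\ lhs c = u, rhs c = v & exists r, rels c = [set r]].

Definition atomic (V : Type) (N : network V) : Prop :=
  forall u v : V, u <> v ->
    exists2 c, N c &
      is_singleton_constraint c u v \/ is_singleton_constraint c v u.

Definition network_over (V : Type) (B : set rcc8) (N : network V) : Prop :=
  forall c, N c -> rels c `<=` B.

Definition solution (V : Type) (N : network V) (T : topologicalType)
    (S : V -> set T) : Prop :=
  (forall v, region (S v)) /\
  (forall c, N c ->
    exists2 r, rels c r & rcc8_holds r (S (lhs c)) (S (rhs c))).

Definition consistent (R : realType) (V : Type) (N : network V) : Prop :=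
  exists n : nat, (0 < n)%N /\ exists S : V -> set 'rV[R]_n, solution N S.

Definition convex_solution (R : realType) (n : nat) (V : Type) (N : network V)
    (S : V -> set 'rV[R]_n) : Prop :=
  solution N S /\ (forall v, convex_set (S v)).

(* Main.v *)
(* Two regions of the given solution are nested or have disjoint interiors, so
   inclusion makes the variables a forest. Give every v an own leaf [inl v] and
   an outer neighbour [inr v], a virtual region just outside v but inside every
   larger region. Then u EC v is witnessed by a contact of [inl u] with [inl v],
   and u TPP v by a contact of [inl u] with [inr v]: tangential inclusion has
   become external contact. Every contact e gets a point p e of R^4, and the
   region of v is cut out by half-spaces that contain the contact points of the
   leaves below v, pushed inwards away from the points that it must not touch.

   The points are found by splitting the set of leaves recursively into two
   parts C and D compatible with the forest. The contacts between C and D lie in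
   the hyperplane X = 0, at the points (u, v, v^2 - u^2) of a saddle, u and v
   being positions of the two leaves in C and D. If a in C and b in D do not
   touch and occupy the intervals ]g, d[ and ]g', d'[ of positions, then
   (v - g')(v - d') - (u - g)(u - d) is affine on the saddle, positive on the
   contacts of a and negative on those of b. The contacts inside C are sent far
   away on the side X > 0 by an affine map; seen from there the other contacts
   of C are arbitrarily close to a line, ordered by position, which is the
   induction hypothesis for C. *)
Require Import Defs.
From mathcomp Require Import all_boot all_order all_algebra.
From mathcomp Require boolp.
From mathcomp Require Import ring lra zify.

Set Implicit Arguments.
Unset Strict Implicit.
Unset Printing Implicit Defensive.

Import Order.TTheory GRing.Theory Num.Theory.
Local Open Scope ring_scope.

(** * Small perturbations, affine functions on R^4, splitting of laminar families *)

Lemma exists_small (R : realFieldType) (I : finType) (A B : I -> R) :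
  exists2 d, 0 < d & forall i, 0 < A i -> 0 < A i + d * B i.
Proof.
(* The sum bounds every ratio |B i| / A i at once; the 1 added to it makes the bound strict and
   keeps the inverse meaningful when s = 0. *)
pose s := \sum_(i | 0 < A i) `|B i| / A i.
have s_ge0 : 0 <= s by apply: sumr_ge0 => i Ai; rewrite divr_ge0 // ltW.
have d_gt0 : 0 < (1 + s)^-1 by rewrite invr_gt0; lra.
exists (1 + s)^-1 => // i Ai.
have le_s : `|B i| / A i <= s.
  rewrite /s (bigD1 i) //= lerDl; apply: sumr_ge0 => j /andP[Aj _].
  by rewrite divr_ge0 // ltW.
have : `|B i| < A i * (1 + s) by rewrite mulrC -ltr_pdivrMr //; lra.
rewrite -ltr_pdivrMr; last by lra.
move=> lt_A.
have := ler_norm (- ((1 + s)^-1 * B i)).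
rewrite normrN normrM (gtr0_norm d_gt0) mulrC; lra.
Qed.

Record point4 (R : Type) := Point4 { cX : R; cA : R; cB : R; cC : R }.

Record affine4 (R : Type) := Affine4 { k0 : R; kX : R; kA : R; kB : R; kC : R }.

Definition value (R : pzRingType) (f : affine4 R) (q : point4 R) : R :=
  k0 f + kX f * cX q + kA f * cA q + kB f * cB q + kC f * cC q.

Definition oppa (R : pzRingType) (f : affine4 R) : affine4 R :=
  Affine4 (- k0 f) (- kX f) (- kA f) (- kB f) (- kC f).

Lemma value_oppa (R : comPzRingType) (f : affine4 R) q :
  value (oppa f) q = - value f q.
Proof. rewrite /value /=; ring. Qed.

(** The mirror symmetry that exchanges the two parts of a split: the sides of X = 0 and the two
    position coordinates trade places. *)
Definition flip (R : pzRingType) (q : point4 R) : point4 R :=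
  Point4 (- cX q) (cA q) (cC q) (cB q).

Lemma flipK (R : pzRingType) : involutive (@flip R).
Proof. by case=> x a b c; rewrite /flip /= opprK. Qed.

Definition flip_affine (R : pzRingType) (f : affine4 R) : affine4 R :=
  Affine4 (k0 f) (- kX f) (kA f) (kC f) (kB f).

Lemma value_flip (R : comPzRingType) (f : affine4 R) q :
  value (flip_affine f) (flip q) = value f q.
Proof. rewrite /value /=; ring. Qed.

(** Split off a maximal member M of F properly inside C. By laminarity any other such member lies in
    M, is disjoint from M, or contains M and then equals it by maximality. *)
Lemma laminar_split (L : finType) (F : {set {set L}}) (C : {set L}) :
  (forall a b, a \in F -> b \in F ->
     [|| a \subset b, b \subset a | [disjoint a & b]]) ->
  set0 \notin F -> (1 < #|C|)%N ->
  exists C1 C2 : {set L},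
    [/\ C = C1 :|: C2, [disjoint C1 & C2], C1 != set0 /\ C2 != set0 &
     forall a, a \in F -> a \proper C -> (a \subset C1) || (a \subset C2)].
Proof.
move=> lamF F0 C_gt1.
have [/existsP[D /andP[FD ltDC]] | noD] :=
    boolP [exists D, (D \in F) && (D \proper C)].
- have [M /maxsetP[/andP[FM ltMC] maxM] _] :
      {M | maxset (fun D => (D \in F) && (D \proper C)) M & D \subset M}.
    by apply: maxset_exists; rewrite FD.
  exists M, (C :\: M); split.
  + by rewrite -{1}(setID C M) (setIidPr (proper_sub ltMC)).
  + by rewrite -setI_eq0 setIDA setDIl setDv set0I.
  + split; first by apply: contraNneq F0 => <-.
    by rewrite setD_eq0; case/properP: ltMC => _ [x Cx Mx];
      apply/subsetPn; exists x.
  move=> a Fa ltaC; case/or3P: (lamF a M Fa FM) => [-> // | leMa | dis].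
    by rewrite (maxM a) ?subxx // Fa.
  by apply/orP; right; rewrite subsetD (proper_sub ltaC).
(* No member of F lies properly inside C, so any split into nonempty parts will do. *)
have [x Cx] : exists x, x \in C by apply/card_gt0P/ltnW.
exists [set x], (C :\ x); split.
- by rewrite setD1K.
- by rewrite disjoints1 !inE eqxx.
- split; first by apply/set0Pn; exists x; rewrite inE.
  by rewrite -card_gt0; move: C_gt1; rewrite (cardsD1 x C) Cx.
move=> a Fa ltaC; case/negP: noD; apply/existsP; exists a.
by rewrite Fa.
Qed.

(** * Contacts and their separation by affine functions *)

Section Labels.

Variables (R : realFieldType) (L : finType) (touch : rel L).
Implicit Types (s : bool) (D C a b : {set L}) (e : L * L).
Implicit Types (p r : L * L -> point4 R).

(* A contact is a touching pair e of leaves; e = (x, x) is private to x. *)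
Definition hit D e := touch e.1 e.2 && ((e.1 \in D) || (e.2 \in D)).

(** A private contact is never inner: it stays on the line of outer contacts throughout the
    recursion. *)
Definition inner D e := [&& touch e.1 e.2, e.1 \in D, e.2 \in D & e.1 != e.2].

(* [f] may vanish only at contacts of [a] with the rest of [C], and nowhere
   when [s] is set. *)
Definition nonneg_on C s a p (f : affine4 R) : Prop :=
  forall e, hit a e -> 0 <= value f (p e) /\
    (s || ~~ hit (C :\: a) e -> 0 < value f (p e)).

Definition separable C p s a b : Prop :=
  exists f, nonneg_on C s a p f /\ nonneg_on C s b p (oppa f).

(** The flag [s] asks for strict separation, which a shared contact would rule out. *)
Definition admissible s a b : Prop :=
  [disjoint a & b] /\ (s -> forall e, ~~ (hit a e && hit b e)).

Lemma hitS D C e : D \subset C -> hit D e -> hit C e.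
Proof.
move=> /subsetP sDC /andP[te /orP[/sDC | /sDC] De];
  by rewrite /hit te De ?orbT.
Qed.

Lemma hitU D C e : hit (D :|: C) e = hit D e || hit C e.
Proof. by rewrite /hit !inE -andb_orr orbACA. Qed.

Lemma inner_hit D e : inner D e -> hit D e.
Proof. by case/and4P=> te De _ _; rewrite /hit te De. Qed.

Lemma innerU_l D C e : ~~ hit C e -> inner (D :|: C) e = inner D e.
Proof.
rewrite /hit /inner !inE; case: (touch _ _) => //=.
by rewrite negb_or => /andP[/negPf-> /negPf->]; rewrite !orbF.
Qed.

Lemma hit_both_inner D C e : [disjoint D & C] -> hit D e -> hit C e ->
  [/\ inner (D :|: C) e, ~~ inner D e & ~~ inner C e].
Proof.
move=> dis; have disE x : x \in D -> x \in C = false.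
  by move=> xD; apply: (disjointFr dis xD).
rewrite /hit /inner !inE => /andP[-> /=].
have := disE e.1; have := disE e.2.
case: (eqVneq e.1 e.2) => [<- | _];
  case: (e.1 \in D); case: (e.1 \in C); case: (e.2 \in D); case: (e.2 \in C);
  move=> h1 h2 //=;
  by [have := h1 isT | have := h2 isT].
Qed.

(** An outer contact of D has only one leaf in D. Hence separators are strictly positive at the
    outer contacts of [a], which leaves room for a perturbation. *)
Lemma outer_hitD D a e : a \subset D -> hit a e -> ~~ inner D e ->
  ~~ hit (D :\: a) e.
Proof.
move=> /subsetP saD /andP[te ae]; apply: contraNN => /andP[_].
rewrite /inner te !inE /=; case/orP=> /andP[nae De]; move: ae;
  rewrite (negPf nae) ?orbF /= => ae; rewrite De (saD _ ae) /=.
  by apply: contraNneq nae => ->.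
by apply: contraNneq nae => <-.
Qed.

Lemma nonneg_onS C D s a p f : D \subset C -> nonneg_on D s a p f ->
  nonneg_on C s a p f.
Proof.
move=> sDC pos e ae; have [ge0 gt0] := pos e ae; split=> // h.
apply: gt0; case: s h {pos} => //=; apply: contraNN.
by apply: hitS; apply: setSD.
Qed.

Lemma separable_sym C p s a b : separable C p s a b -> separable C p s b a.
Proof.
case=> f [fa fb]; exists (oppa f); split=> // e ae.
have := fa e ae; rewrite !value_oppa opprK; exact.
Qed.

Lemma separable_flip C p s a b :
  separable C (flip (R := R) \o p) s a b -> separable C p s a b.
Proof.
case=> f [fa fb]; exists (flip_affine f).
have vE q : value (flip_affine f) q = value f (flip q).
  by rewrite -(value_flip _ (flip q)) flipK.
split=> e he.
  by rewrite vE; apply: fa.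
by have := fb e he; rewrite !value_oppa vE.
Qed.

(* [stretch_affine] is the pullback by the inverse of [stretch], which sends a
   point with u = cB + 4 cX - 2 close to (u, 0, 0, 0) when [d] is small. The
   factor [k] keeps cA positive. *)
Definition stretch (d k : R) (q : point4 R) : point4 R :=
  Point4 (cA q / (4 * d)) ((cA q + k * cC q) / d)
        (cX q - cA q / d + 2) (cB q / d + cA q / d + 2).

Definition stretch_affine (d k : R) (f : affine4 R) : affine4 R :=
  Affine4 (k0 f - 2 * kX f - 2 * d * kB f)
         (4 * (kX f + d * kA f - d * kB f - d * kC f / k))
         (d * kC f / k) (kX f) (d * kB f).

Lemma value_stretch d k f q : d != 0 -> k != 0 ->
  value (stretch_affine d k f) (stretch d k q) = value f q.
Proof. by move=> nz_d nz_k; rewrite /value /=; field; rewrite nz_d nz_k. Qed.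

(** For the pulled-back function, an outer contact acts as the point of the X-axis at its position,
    up to an error proportional to [d]. *)
Lemma value_stretch_outer d k f q : k != 0 ->
  value (stretch_affine d k f) q =
  value f (Point4 (cB q + 4 * cX q - 2) 0 0 0)
  + d * (4 * kA f * cX q + kB f * (cC q - 4 * cX q - 2)
         + kC f * (cA q - 4 * cX q) / k).
Proof. by move=> nz_k; rewrite /value /=; field. Qed.

(** Pulling a separator back changes nothing at inner contacts. At outer ones the old value was
    strictly positive and survives an error of order [d]. The map [h] is found before [q], since the
    final placement combines the maps of both parts. *)
Lemma stretch_separable (Q : bool -> {set L} -> {set L} -> Prop) C D p r :
  D \subset C ->
  (forall e, hit D e -> ~~ inner D e ->
     p e = Point4 (cB (r e) + 4 * cX (r e) - 2) 0 0 0) ->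
  (forall e, inner D e -> 0 < cA (p e)) ->
  (forall s a b, Q s a b -> a \subset D -> b \subset D ->
     separable D p s a b) ->
  exists h : point4 R -> point4 R,
    (forall e, inner D e -> 0 < cX (h (p e)) /\ 0 < cA (h (p e))) /\
    forall q, (forall e, hit D e -> q e = if inner D e then h (p e) else r e) ->
      forall s a b, Q s a b -> a \subset D -> b \subset D ->
      separable C q s a b.
Proof.
move=> sDC pE pA sep.
have [k k_gt0 kP] := exists_small (fun e => cA (p e)) (fun e => cC (p e)).
(* All separators are fixed first, because a single [d] must suit them all. *)
have [f fP] : exists f : bool * {set L} * {set L} -> affine4 R, forall t,
    Q t.1.1 t.1.2 t.2 -> t.1.2 \subset D -> t.2 \subset D ->
    nonneg_on D t.1.1 t.1.2 p (f t) /\ nonneg_on D t.1.1 t.2 p (oppa (f t)).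
  suff /boolp.choice[f fP] : forall t, exists f, (fun t f => Q t.1.1 t.1.2 t.2 ->
    t.1.2 \subset D -> t.2 \subset D -> nonneg_on D t.1.1 t.1.2 p f
    /\ nonneg_on D t.1.1 t.2 p (oppa f)) t f by exists f.
  move=> t.
  have [[Qt [sa sb]] | nQ] :=
      boolp.pselect (Q t.1.1 t.1.2 t.2 /\ t.1.2 \subset D /\ t.2 \subset D).
    by have [f fP] := sep _ _ _ Qt sa sb; exists f.
  by exists (Affine4 0 0 0 0 0) => Qt sa sb; case: nQ.
(* The coefficient of [d] in [value_stretch_outer]. *)
pose slope (f : affine4 R) e := 4 * kA f * cX (r e)
  + kB f * (cC (r e) - 4 * cX (r e) - 2) + kC f * (cA (r e) - 4 * cX (r e)) / k.
pose sf (i : bool * {set L} * {set L} * bool) :=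
  if i.2 then f i.1 else oppa (f i.1).
have [d d_gt0 dP] := exists_small (fun i => value (sf i.1) (p i.2))
  (fun i : bool * {set L} * {set L} * bool * (L * L) => slope (sf i.1) i.2).
have nz_k : k != 0 by rewrite gt_eqF.
have nz_d : d != 0 by rewrite gt_eqF.
exists (stretch d k); split=> [e De | q qE s a b Qab sa sb].
  have pe_gt0 := pA e De.
  split; first by rewrite /= divr_gt0 // mulr_gt0.
  by rewrite /= divr_gt0 //; apply: kP.
have side (c : {set L}) g : c \subset D -> nonneg_on D s c p (sf (s, a, b, g)) ->
    nonneg_on C s c q (stretch_affine d k (sf (s, a, b, g))).
  move=> sc pos; apply: (nonneg_onS sDC) => e ce.
  have De := hitS sc ce; have [ge0 gt0] := pos e ce.
  rewrite qE //; case: ifP => inD; first by rewrite value_stretch.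
  have lt0 : 0 < value (stretch_affine d k (sf (s, a, b, g))) (r e).
    rewrite value_stretch_outer // -pE ?inD //.
    apply: (dP (s, a, b, g, e)); apply: gt0.
    by rewrite outer_hitD ?inD ?orbT.
  by split=> //; apply: ltW.
have [fa fb] := fP (s, a, b) Qab sa sb.
exists (stretch_affine d k (f (s, a, b))); split; first exact: (side a true).
move=> e be; have := side b false sb fb e be.
rewrite (_ : value (stretch_affine _ _ _) _ =
  value (oppa (stretch_affine d k (f (s, a, b)))) (q e)) //.
by rewrite /value /= ; field.
Qed.

(** The coordinate X separates weakly and vanishes only at contacts between C and D. For strict
    separation it is tilted by a small multiple of a function with the right signs on the saddle;
    contacts off X = 0 keep their side. *)
Lemma cross_separable C D p s a b (ga da gb db : R) :
  ga < da -> gb < db ->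
  (forall e, hit C e -> ~~ hit D e -> 0 < cX (p e)) ->
  (forall e, hit D e -> ~~ hit C e -> cX (p e) < 0) ->
  (forall e, hit C e -> hit D e -> exists u v,
     [/\ p e = Point4 0 (v ^+ 2 - u ^+ 2 + 1) (u + 2) (v + 2),
         hit a e = (ga < u < da) & hit b e = (gb < v < db)]) ->
  [disjoint C & D] -> a \subset C -> b \subset D -> admissible s a b ->
  separable (C :|: D) p s a b.
Proof.
move=> lt_a lt_b pC pD pCD dis sa sb [_ adm].
have sCb : C \subset (C :|: D) :\: b.
  by rewrite subsetD subsetUl disjoint_sym (disjointWl sb) // disjoint_sym.
have sDa : D \subset (C :|: D) :\: a.
  by rewrite subsetD subsetUr disjoint_sym (disjointWl sa).
case: s adm => [/(_ isT) adm | _].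
  (* This is (v - gb)(v - db) - (u - ga)(u - da), with v^2 - u^2, u and v replaced by cA - 1, cB + 4
     cX - 2 and cC - 4 cX - 2. *)
  pose g := Affine4 (-1 + 2 * (gb + db) + gb * db - 2 * (ga + da) - ga * da)
    (4 * (gb + db + ga + da)) 1 (ga + da) (- (gb + db)).
  pose sgn (x : R) (t : bool) := if t then x else - x.
  have [k k_gt0 kP] := exists_small
    (fun i : L * L * bool => sgn (cX (p i.1)) i.2)
    (fun i : L * L * bool => sgn (value g (p i.1)) i.2).
  pose f := Affine4 (k * k0 g) (1 + k * kX g) (k * kA g) (k * kB g) (k * kC g).
  have fE q : value f q = cX q + k * value g q by rewrite /value /=; ring.
  exists f; split=> e he; rewrite ?value_oppa fE.
    suff lt0 : 0 < cX (p e) + k * value g (p e) by split; first exact: ltW.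
    have Ce := hitS sa he; have [De | nDe] := boolP (hit D e); last first.
      by apply: (kP (e, true)); apply: pC.
    have [u [v [-> ha hb]]] := pCD e Ce De.
    (* No contact is shared, so v lies outside ]gb, db[ while u lies inside ]ga, da[: one product is
       nonnegative, the other positive. *)
    have nbe : ~~ hit b e by have := adm e; rewrite he.
    rewrite add0r pmulr_rgt0 //.
    have -> : value g (Point4 0 (v ^+ 2 - u ^+ 2 + 1) (u + 2) (v + 2)) =
        (v - gb) * (v - db) + (u - ga) * (da - u).
      by rewrite /value /=; ring.
    have /andP[lt_u lt_u'] : ga < u < da by rewrite -ha.
    have pos_u : 0 < (u - ga) * (da - u) by rewrite mulr_gt0 ?subr_gt0.
    rewrite ltr_wpDl // {pos_u}; move: nbe; rewrite hb negb_and -!leNgt.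
    by case/orP=> le_v; [rewrite mulr_le0 | rewrite mulr_ge0]; lra.
  suff lt0 : 0 < - (cX (p e) + k * value g (p e)) by split; first exact: ltW.
  have De := hitS sb he; have [Ce | nCe] := boolP (hit C e); last first.
    rewrite opprD -mulrN; apply: (kP (e, false)).
    by rewrite /= oppr_gt0; apply: pD.
  have [u [v [-> ha hb]]] := pCD e Ce De.
  have nae : ~~ hit a e by have := adm e; rewrite he andbT.
  rewrite add0r -mulrN pmulr_rgt0 //.
  have -> : - value g (Point4 0 (v ^+ 2 - u ^+ 2 + 1) (u + 2) (v + 2)) =
      (v - gb) * (db - v) + (u - ga) * (u - da).
    by rewrite /value /=; ring.
  have /andP[lt_v lt_v'] : gb < v < db by rewrite -hb.
  have pos_v : 0 < (v - gb) * (db - v) by rewrite mulr_gt0 ?subr_gt0.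
  rewrite ltr_wpDr // {pos_v}; move: nae; rewrite ha negb_and -!leNgt.
  by case/orP=> le_u; [rewrite mulr_le0 | rewrite mulr_ge0]; lra.
(* Weak separation: X itself, which is 0 exactly at the contacts between C and D. *)
exists (Affine4 0 1 0 0 0); split=> e he; rewrite ?value_oppa /=.
  have vE : value (Affine4 0 1 0 0 0) (p e) = cX (p e) by rewrite /value /=; ring.
  rewrite vE; have Ce := hitS sa he; have [De | nDe] := boolP (hit D e).
    have [u [v [-> _ _]]] := pCD e Ce De.
    by rewrite (hitS sDa De).
  by have := pC e Ce nDe; split; first exact: ltW.
have vE : value (Affine4 0 1 0 0 0) (p e) = cX (p e) by rewrite /value /=; ring.
rewrite vE; have De := hitS sb he; have [Ce | nCe] := boolP (hit C e).
  have [u [v [-> _ _]]] := pCD e Ce De.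
  by rewrite (hitS sCb Ce) oppr0.
by rewrite oppr_ge0 oppr_gt0; have := pD e De nCe; split; first exact: ltW.
Qed.

(* The coordinate cA is bounded below by 0 on inner contacts so that [stretch]
   can send them into the half-space X > 0. *)
Definition realizes (F : {set {set L}}) C p : Prop :=
  [/\ forall e, hit C e -> ~~ inner C e ->
        exists2 u, -1 < u < 1 & p e = Point4 u 0 0 0,
      forall e, inner C e -> 0 < cA (p e),
      forall a, a \in F -> a \subset C -> exists g d,
        [/\ -1 <= g, g < d, d <= 1 & forall e, hit C e -> ~~ inner C e ->
           hit a e = (g < cX (p e) < d)] &
      forall s a b, [/\ a \in F, b \in F & admissible s a b] ->
        a \subset C -> b \subset C -> separable C p s a b].

(** * Recursive placement of the contacts *)

Lemma realizes_set1 (F : {set {set L}}) x : set0 \notin F ->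
  realizes F [set x] (fun=> Point4 0 0 0 0).
Proof.
move=> F0; split.
- by move=> e _ _; exists 0 => //; lra.
- by move=> e /and4P[_ /set1P-> /set1P->]; rewrite eqxx.
- move=> a Fa; rewrite subset1 => /orP[/eqP-> | /eqP a0]; last first.
    by rewrite -a0 Fa in F0.
  exists (-1), 1; split=> //; first lra.
  by move=> e -> _ /=; lra.
(* Two disjoint nonempty sets cannot both lie in a singleton. *)
move=> s a b [Fa Fb [dis _]].
have nz c : c \in F -> c != set0 by apply: contraTneq => ->.
rewrite !subset1 !(negPf (nz _ _)) // !orbF => /eqP aE /eqP bE.
by move: dis; rewrite aE bE -setI_eq0 setIid -aE (negPf (nz _ _)).
Qed.

(** Pairs inside C are handled by stretching, pairs inside D by stretching in the mirror, and pairs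
    across by the saddle. A disjoint pair falls under one of these cases, since neither member can
    be all of the union. *)
Lemma realizes_setU (F : {set {set L}}) C D p r :
  (forall a, a \in F -> a \proper C :|: D ->
     (a \subset C) || (a \subset D)) ->
  set0 \notin F -> [disjoint C & D] ->
  realizes F C p -> realizes F D r -> exists q, realizes F (C :|: D) q.
Proof.
move=> splitF F0 dis [outC inC posC sepC] [outD inD posD sepD].
(* The contacts of C and of D with the outside keep their order on the
   X-axis, rescaled to ]0, 1[ for C and reversed in ]-1, 0[ for D. *)
pose base e := if hit C e && hit D e then
    Point4 0 (cX (r e) ^+ 2 - cX (p e) ^+ 2 + 1) (cX (p e) + 2) (cX (r e) + 2)
  else if hit C e then Point4 ((cX (p e) + 2) / 4) 0 0 0
  else Point4 (- ((cX (r e) + 2) / 4)) 0 0 0.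
have [h [hC sepC']] : exists h : point4 R -> point4 R,
    (forall e, inner C e -> 0 < cX (h (p e)) /\ 0 < cA (h (p e))) /\
    forall q,
      (forall e, hit C e -> q e = if inner C e then h (p e) else base e) ->
      forall s a b, [/\ a \in F, b \in F & admissible s a b] ->
      a \subset C -> b \subset C -> separable (C :|: D) q s a b.
  apply: stretch_separable (subsetUl C D) _ inC sepC => e Ce nCe.
  have [u _ pe] := outC e Ce nCe.
  (* The position u is recovered on both kinds of outer contacts of C: cB = u + 2 on the saddle,
     where X = 0, and cX = (u + 2) / 4 on the X-axis, where cB = 0. *)
  by rewrite /base Ce /= pe; case: ifP => _ /=; congr Point4; field.
have [h' [hD sepD']] : exists h : point4 R -> point4 R,
    (forall e, inner D e -> 0 < cX (h (r e)) /\ 0 < cA (h (r e))) /\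
    forall q,
      (forall e, hit D e -> q e = if inner D e then h (r e)
         else flip (base e)) ->
      forall s a b, [/\ a \in F, b \in F & admissible s a b] ->
      a \subset D -> b \subset D -> separable (C :|: D) q s a b.
  apply: stretch_separable (subsetUr C D) _ inD sepD => e De nDe.
  have [u _ re] := outD e De nDe.
  by rewrite /base De andbT re; case: (hit C e) => /=; congr Point4; field.
pose q e := if inner C e then h (p e)
  else if inner D e then flip (h' (r e)) else base e.
have hit2 e : hit C e -> hit D e -> [/\ inner (C :|: D) e, ~~ inner C e
    & ~~ inner D e] by apply: hit_both_inner.
have qC e : hit C e -> q e = if inner C e then h (p e) else base e.
  move=> Ce; rewrite /q; case: ifP => // _; case: ifP => // De.
  by have [_ _] := hit2 e Ce (inner_hit De); rewrite De.
have qD e : hit D e -> q e = if inner D e then flip (h' (r e)) else base e.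
  move=> De; rewrite /q; case: ifP => // Ce.
  by have [_] := hit2 e (inner_hit Ce) De; rewrite Ce.
have innerC e : ~~ hit D e -> inner (C :|: D) e = inner C e.
  exact: innerU_l.
have innerD e : ~~ hit C e -> inner (C :|: D) e = inner D e.
  by rewrite setUC; apply: innerU_l.
have outq e : hit (C :|: D) e -> ~~ inner (C :|: D) e ->
    [/\ hit C e, ~~ hit D e, ~~ inner C e
          & q e = Point4 ((cX (p e) + 2) / 4) 0 0 0]
    \/ [/\ hit D e, ~~ hit C e, ~~ inner D e
          & q e = Point4 (- ((cX (r e) + 2) / 4)) 0 0 0].
  rewrite hitU; have [Ce | nCe] := boolP (hit C e); last first.
    rewrite /= => De nin; right; rewrite innerD // in nin.
    by split=> //; rewrite qD // (negPf nin) /base (negPf nCe).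
  have [De | nDe] := boolP (hit D e); first by have [->] := hit2 e Ce De.
  move=> _ nin; left; rewrite innerC // in nin.
  by split=> //; rewrite qC // (negPf nin) /base Ce (negPf nDe).
exists q; split.
- move=> e Ue nUe; have [[Ce nDe nCe ->] | [De nCe nDe ->]] := outq e Ue nUe.
    have [u u1 ->] := outC e Ce nCe; exists ((u + 2) / 4) => //=; lra.
  have [u u1 ->] := outD e De nDe; exists (- ((u + 2) / 4)) => //=; lra.
- move=> e Ue; have := inner_hit Ue; rewrite hitU.
  have [Ce | nCe] := boolP (hit C e); last first.
    move=> /= De; have iD : inner D e by rewrite -innerD.
    by rewrite qD // iD; have [] := hD e iD.
  have [De | nDe] := boolP (hit D e); last first.
    move=> _; have iC : inner C e by rewrite -innerC.
    by rewrite qC // iC; have [] := hC e iC.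
  move=> _; have [_ nC nD] := hit2 e Ce De.
  (* The shift by 1 in cA makes v^2 - u^2 + 1 positive, as |u| < 1. *)
  rewrite qC // (negPf nC) /base Ce De /=.
  have [u /andP[u1 u2] ->] := outC e Ce nC; have := sqr_ge0 (cX (r e)).
  have : 0 < (1 - u) * (1 + u) by rewrite mulr_gt0; lra.
  by rewrite /= expr2; nra.
- move=> a Fa sa; have [aC | naC] := boolP (a \subset C).
    have [g [d [g1 gd d1 aE]]] := posC a Fa aC.
    exists ((g + 2) / 4), ((d + 2) / 4); split; [lra | lra | lra |].
    move=> e Ue nUe; have [[Ce nDe nCe ->] | [De nCe nDe ->]] := outq e Ue nUe.
      by rewrite aE //=; apply/idP/idP; lra.
    rewrite (contraNF (hitS aC) nCe) /=.
    by have [u u1 ->] := outD e De nDe; apply/esym/negbTE => /=; lra.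
  have [aD | naD] := boolP (a \subset D).
    have [g [d [g1 gd d1 aE]]] := posD a Fa aD.
    exists (- ((d + 2) / 4)), (- ((g + 2) / 4)); split; [lra | lra | lra |].
    move=> e Ue nUe; have [[Ce nDe nCe ->] | [De nCe nDe ->]] := outq e Ue nUe.
      rewrite (contraNF (hitS aD) nDe) /=.
      by have [u u1 ->] := outC e Ce nCe; apply/esym/negbTE => /=; lra.
    by rewrite aE //=; apply/idP/idP; lra.
  (* A member inside neither part is the whole union, and its interval is all of ]-1, 1[. *)
  have aE : a = C :|: D.
    apply/eqP; rewrite eqEproper sa; apply/negP => /(splitF a Fa).
    by rewrite (negPf naC) (negPf naD).
  exists (-1), 1; split=> //; first lra.
  move=> e Ue nUe; rewrite aE Ue.
  have [[Ce nDe nCe ->] | [De nCe nDe ->]] := outq e Ue nUe.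
    by have [u u1 ->] := outC e Ce nCe => /=; lra.
  by have [u u1 ->] := outD e De nDe => /=; lra.
have qpos e : hit C e -> ~~ hit D e -> 0 < cX (q e).
  move=> Ce nDe; rewrite qC //; case: ifPn => iC; first by have [] := hC e iC.
  rewrite /base Ce (negPf nDe) /=.
  by have [u u1 ->] := outC e Ce iC => /=; lra.
have qneg e : hit D e -> ~~ hit C e -> cX (q e) < 0.
  move=> De nCe; rewrite qD //; case: ifPn => iD.
    by have [] := hD e iD; rewrite /= oppr_lt0.
  rewrite /base De (negPf nCe) /=.
  by have [u u1 ->] := outD e De iD => /=; lra.
have cross s a b : a \in F -> b \in F -> a \subset C -> b \subset D ->
    admissible s a b -> separable (C :|: D) q s a b.
  move=> Fa Fb aC bD adm.
  have [ga [da [_ lt_a _ aE]]] := posC a Fa aC.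
  have [gb [db [_ lt_b _ bE]]] := posD b Fb bD.
  apply: (cross_separable lt_a lt_b qpos qneg) => // e Ce De.
  exists (cX (p e)), (cX (r e)); have [_ nC nD] := hit2 e Ce De.
  by rewrite aE // bE // qC // (negPf nC) /base Ce De.
have proper a b : a \in F -> b \in F -> a \subset C :|: D ->
    b \subset C :|: D -> [disjoint a & b] -> a \proper C :|: D.
  move=> Fa Fb sa sb dab; rewrite properEneq sa andbT.
  apply: contraNneq F0 => aE; move: sb; rewrite -aE => /setIidPl.
  by move: dab; rewrite disjoint_sym -setI_eq0 => /eqP-> ->.
move=> s a b [Fa Fb adm] sa sb; have [dab hab] := adm.
have adm' : admissible s b a.
  split; first by rewrite disjoint_sym.
  by move=> hs e; rewrite andbC; apply: hab.
have dba : [disjoint b & a] by rewrite disjoint_sym.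
have /orP[aC | aD] := splitF a Fa (proper a b Fa Fb sa sb dab);
  have /orP[bC | bD] := splitF b Fb (proper b a Fb Fa sb sa dba).
- exact: sepC'.
- exact: cross.
- by apply: separable_sym; apply: cross.
apply: separable_flip; apply: sepD' => // e De.
by rewrite /= qD //; case: ifP => // _; rewrite flipK.
Qed.

Theorem laminar_realizes (F : {set {set L}}) C :
  (forall a b, a \in F -> b \in F ->
     [|| a \subset b, b \subset a | [disjoint a & b]]) ->
  set0 \notin F -> C != set0 -> exists p, realizes F C p.
Proof.
move=> lamF F0; have [n] := ubnP #|C|; elim: n C => // n IHn C.
rewrite ltnS => leCn nzC.
have [C_gt1 | C_le1] := ltnP 1 #|C|; last first.
  have /cards1P[x ->] : #|C| == 1 by rewrite eqn_leq C_le1 card_gt0.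
  by exists (fun=> Point4 0 0 0 0); apply: realizes_set1.
have [C1 [C2 [CE dis [nz1 nz2] splitF]]] := laminar_split lamF F0 C_gt1.
have cardC : #|C| = (#|C1| + #|C2|)%N.
  by rewrite CE cardsU (disjoint_setI0 dis) cards0 subn0.
move: nz1 nz2; rewrite -!card_gt0 => nz1 nz2.
have [p pC1] : exists p, realizes F C1 p.
  by apply: IHn; rewrite -?card_gt0 //; lia.
have [r rC2] : exists p, realizes F C2 p.
  by apply: IHn; rewrite -?card_gt0 //; lia.
rewrite CE in splitF *; exact: realizes_setU splitF F0 dis pC1 rC2.
Qed.

End Labels.

(** * Cells cut out by the separating half-spaces *)

Definition weakly (R : numDomainType) (J : Type) (P : pred J)
    (g : J -> affine4 R) (c : J -> R) (q : point4 R) : Prop :=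
  forall j, P j -> c j <= value (g j) q.

Definition strictly (R : numDomainType) (J : Type) (P : pred J)
    (g : J -> affine4 R) (c : J -> R) (q : point4 R) : Prop :=
  forall j, P j -> c j < value (g j) q.

(** The cell of [a] uses one half-space for each side, containing [a], of a separated pair. A larger
    set uses fewer of them and smaller offsets, so cells grow with their sets. *)
Theorem laminar_cells (R : realFieldType) (L : finType) (touch : rel L)
    (F : {set {set L}}) (x0 : L) :
  (forall a b, a \in F -> b \in F ->
     [|| a \subset b, b \subset a | [disjoint a & b]]) ->
  set0 \notin F -> reflexive touch ->
  exists (p : L * L -> point4 R) (J : finType) (g : J -> affine4 R)
    (P : {set L} -> pred J) (c : {set L} -> J -> R),
  [/\ forall a e, hit touch a e -> weakly (P a) g (c a) (p e),
      forall (a : {set L}) x, x \in a -> strictly (P a) g (c a) (p (x, x)),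
      forall (a b : {set L}) q, a \subset b ->
        weakly (P a) g (c a) q -> weakly (P b) g (c b) q,
      forall (a b : {set L}) q, a \proper b ->
        (forall e, hit touch a e -> ~~ hit touch (~: b) e) ->
        weakly (P a) g (c a) q -> strictly (P b) g (c b) q &
      forall a b, a \in F -> b \in F -> [disjoint a & b] ->
        (exists f, [/\ forall q, weakly (P a) g (c a) q -> 0 <= value f q,
           forall q, weakly (P b) g (c b) q -> value f q <= 0 &
           forall x, x \in a -> 0 < value f (p (x, x))]) /\
        ((forall e, ~~ (hit touch a e && hit touch b e)) ->
         forall q, weakly (P a) g (c a) q -> ~ weakly (P b) g (c b) q)].
Proof.
move=> lamF F0 touch_refl.
have [p [_ _ _ sep]] : exists p : L * L -> point4 R, realizes touch F [set: L] p.
  by apply: laminar_realizes => //; apply/set0Pn; exists x0.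
pose I : finType := (bool * {set L} * {set L})%type.
pose ok (t : I) :=
  [/\ t.1.2 \in F, t.2 \in F & admissible touch t.1.1 t.1.2 t.2].
have /boolp.choice[f fP] : forall t : I, exists f, ok t ->
    nonneg_on touch [set: L] t.1.1 t.1.2 p f /\
    nonneg_on touch [set: L] t.1.1 t.2 p (oppa f).
  move=> t; have [okt | nok] := boolp.pselect (ok t); last first.
    by exists (Affine4 0 0 0 0 0) => /nok.
  by have [f fP] := sep _ _ _ okt (subsetT _) (subsetT _); exists f.
pose J : finType := (I * bool)%type.
pose g (j : J) := if j.2 then f j.1 else oppa (f j.1).
pose side (j : J) := if j.2 then j.1.1.2 else j.1.2.
have gP j : ok j.1 -> nonneg_on touch [set: L] j.1.1.1 (side j) p (g j).
  by rewrite /g /side; case: j => t [] /= /fP[].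
(* [k] is so small that even the largest offset stays below every positive value at a contact. *)
have [k k_gt0 kP] := exists_small (fun i : J * (L * L) => value (g i.1) (p i.2))
  (fun i : J * (L * L) => - #|L|.+1%:R).
(* A half-space may be pushed inwards for [a] only if no contact of [a] lies on its boundary. *)
pose pos (a : {set L}) j :=
  [forall e, hit touch a e ==> (0 < value (g j) (p e))].
pose P (a : {set L}) (j : J) := boolp.asbool (ok j.1) && (a \subset side j).
(* The offset grows strictly as [a] shrinks, whence the strict inclusion of
   nontangential parts. *)
pose c (a : {set L}) (j : J) := if pos a j then k * #|~: a|.+1%:R else 0.
have k_lt j e : 0 < value (g j) (p e) -> k * #|L|.+1%:R < value (g j) (p e).
  by move=> /(kP (j, e)) /=; rewrite mulrN subr_gt0.
have c_le a j : c a j <= k * #|L|.+1%:R.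
  rewrite /c; case: ifP => _; last by rewrite mulr_ge0 // ltW.
  by rewrite ler_pM2l // ler_nat ltnS max_card.
(* If [pos b j] fails, the offset of [b] is 0, and the successor in [c] keeps that of [a]
   positive. *)
have c_lt (a b : {set L}) j : a \proper b -> pos a j -> c b j < c a j.
  rewrite /c => lt_ab ->; case: ifP => _; last by rewrite mulr_gt0.
  by rewrite ltr_pM2l // ltr_nat ltnS; apply: proper_card; rewrite properC.
exists p, J, g, P, c; split.
- move=> a e ae j /andP[/boolp.asboolP okj sa].
  have [ge0 _] := gP j okj e (hitS sa ae); rewrite /c.
  case: ifP => // /forallP/(_ e); rewrite ae /= => /k_lt/ltW.
  by apply: le_trans; rewrite ler_pM2l // ler_nat ltnS max_card.
- move=> a x ax j /andP[/boolp.asboolP okj /subsetP sa].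
  apply: le_lt_trans (c_le a j) (k_lt _ _ _).
  have [] := gP j okj (x, x); first by rewrite /hit touch_refl /= sa.
  by move=> _; apply; rewrite /hit !inE /= sa // andbF orbT.
- move=> a b q sab aq j /andP[okj sb].
  apply: le_trans (aq j _); last by rewrite /P okj (subset_trans sab).
  have [-> // | /eqP neq_ab] := eqVneq a b.
  have [pa | npa] := boolP (pos a j).
    by apply/ltW/c_lt => //; rewrite properEneq sab andbT; apply/eqP.
  rewrite /c (negPf npa) ifF //; apply: contraNF npa => /forallP pb.
  by apply/forallP=> e; apply/implyP=> ae; apply: (implyP (pb e)); apply: hitS ae.
- move=> a b q lt_ab nt aq j /andP[okj sb].
  have sab := proper_sub lt_ab.
  apply: lt_le_trans (aq j _); last by rewrite /P okj (subset_trans sab).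
  (* Contacts of [a] do not leave [b], hence do not leave [side j], so the separator is strictly
     positive on them and its offset strictly drops from [a] to [b]. *)
  apply: c_lt => //; apply/forallP=> e; apply/implyP=> ae.
  have [] := gP j (elimT (boolp.asboolP _) okj) e (hitS (subset_trans sab sb) ae).
  move=> _; apply; apply/orP; right; apply: contra (nt e ae).
  by apply: hitS; rewrite setTD setCS.
move=> a b Fa Fb dis; split.
  have okj : ok (false, a, b) by [].
  exists (f (false, a, b)); split=> [q aq | q bq | x ax].
  - have := aq (false, a, b, true); rewrite /P boolp.asboolT // subxx.
    move=> /(_ isT); apply: le_trans; rewrite /c; case: ifP => // _.
    by rewrite mulr_ge0 // ltW.
  - rewrite -oppr_ge0 -value_oppa.
    have := bq (false, a, b, false); rewrite /P boolp.asboolT // subxx.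
    move=> /(_ isT); apply: le_trans; rewrite /c; case: ifP => // _.
    by rewrite mulr_ge0 // ltW.
  have [] := gP (false, a, b, true) okj (x, x).
    by rewrite /hit touch_refl ax.
  by move=> _; apply; rewrite /hit !inE /= ax andbF.
move=> nab q aq bq.
(* For a strict pair both half-spaces are pushed inwards, so the separator would be both positive
   and negative at [q]. *)
have okj : ok (true, a, b) by [].
have lt0 j (d : {set L}) : ok j.1 -> j.1.1.1 -> d = side j ->
    weakly (P d) g (c d) q -> 0 < value (g j) q.
  move=> okj' sj dE dq; have := dq j.
  rewrite /P boolp.asboolT // dE subxx => /(_ isT).
  apply: lt_le_trans; rewrite /c ifT ?mulr_gt0 //.
  apply/forallP=> e; apply/implyP=> de; have [_] := gP j okj' e de.
  by apply; rewrite sj.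
have := lt0 (true, a, b, true) a okj isT erefl aq.
have := lt0 (true, a, b, false) b okj isT erefl bq.
by rewrite /g /= value_oppa oppr_gt0 => /lt_trans h /h; rewrite ltxx.
Qed.

(** * The forest of variables *)

Section Forest.

Variables (V : finType) (le ec tp : rel V).
Hypotheses (le_refl : reflexive le) (le_trans : transitive le)
  (le_anti : antisymmetric le)
  (le_forest : forall x u v, le x u -> le x v -> le u v || le v u).

Definition leaf : finType := (V + V)%type.

Definition below (v : V) : {set leaf} :=
  [set l | match l with inl u => le u v | inr u => le u v && (u != v) end].

(** Singletons are included so that an own leaf or an outer neighbour can be separated from a set
    [below v] that does not contain it. *)
Definition forest_family : {set {set leaf}} :=
  [set below v | v : V] :|: [set [set l] | l : leaf].

Definition touch : rel leaf := fun x y => (x == y) ||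
  match x, y with
  | inl u, inl v => ec u v
  | inl u, inr v => tp u v
  | _, _ => false
  end.

Lemma below_forest_family v : below v \in forest_family.
Proof. by rewrite inE imset_f. Qed.

Lemma set1_forest_family l : [set l] \in forest_family.
Proof. by rewrite inE (imset_f (fun l : leaf => [set l])) ?orbT. Qed.

Lemma belowS u v : le u v -> below u \subset below v.
Proof.
move=> uv; apply/subsetP=> -[] x; rewrite !inE; first by move/le_trans; apply.
case/andP=> xu nxu; rewrite (le_trans xu uv) /=; apply: contraNneq nxu => xv.
by apply/eqP/le_anti; rewrite xu xv.
Qed.

Lemma disjoint_below u v : ~~ le u v -> ~~ le v u -> [disjoint below u & below v].
Proof.
move=> nuv nvu; rewrite -setI_eq0; apply/eqP/setP=> l; rewrite !inE.
have no x : le x u -> le x v -> False.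
  by move=> xu /(le_forest xu); rewrite (negPf nuv) (negPf nvu).
by apply/negbTE/negP; case: l => x /andP[];
  [exact: no | move=> /andP[xu _] /andP[xv _]; apply: no xu xv].
Qed.

Lemma forest_family_laminar a b : a \in forest_family -> b \in forest_family ->
  [|| a \subset b, b \subset a | [disjoint a & b]].
Proof.
have set1 l (c : {set leaf}) : ([set l] \subset c) || [disjoint [set l] & c].
  by rewrite sub1set disjoints1; case: (l \in c).
case/setUP=> /imsetP[u _ ->]; last by case/orP: (set1 u b) => ->; rewrite ?orbT.
case/setUP=> /imsetP[v _ ->]; last first.
  have /orP[-> | dis] := set1 v (below u); first by rewrite orbT.
  by rewrite disjoint_sym dis !orbT.
have [/belowS-> // | nuv] := boolP (le u v).
have [/belowS-> | nvu] := boolP (le v u); first by rewrite orbT.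
by rewrite disjoint_below ?orbT.
Qed.

Lemma set0_forest_family : set0 \notin forest_family.
Proof.
apply/negP => /setUP[] /imsetP[x _] /setP; [move/(_ (inl x)) | move/(_ x)];
  by rewrite !inE ?le_refl ?eqxx.
Qed.

Lemma touch_refl : reflexive touch.
Proof. by move=> x; rewrite /touch eqxx. Qed.

(** The combinatorial form of nontangential inclusion. The hypotheses bound the far end of each
    contact; for a tangential one entered at its outer end y, the chain x <= y <= u <= v does. *)
Lemma hit_below_inside u v : le u v -> u != v ->
  (forall x y, ec x y -> le x u -> le y v) ->
  (forall x y, ec x y -> le y u -> le x v) ->
  (forall x y, tp x y -> le x y) ->
  (forall x y, tp x y -> le x u -> le y v && (y != v)) ->
  forall e, hit touch (below u) e -> ~~ hit touch (~: below v) e.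
Proof.
move=> uv nuv ec1 ec2 tp_le tp1 [x y] /andP[/= txy xyu].
rewrite /hit /= txy /= !in_setC -negb_and negbK.
have sub := subsetP (belowS uv).
have [exy | nxy] := eqVneq x y.
  by subst y; move: xyu; rewrite orbb => /sub ->.
move: txy xyu sub; rewrite /touch (negPf nxy) /=.
case: x {nxy} => x; case: y => y //= txy /orP[] hu sub;
  rewrite (sub _ hu) ?andbT /=.
- by move: hu; rewrite !inE; apply: ec1 txy.
- by move: hu; rewrite !inE; apply: ec2 txy.
- by move: hu; rewrite !inE; apply: tp1 txy.
move: hu; rewrite !inE => /andP[yu _].
exact: le_trans (tp_le _ _ txy) (le_trans yu uv).
Qed.

(** The combinatorial form of disconnection. A shared contact would have one end under each of u and
    v; a tangential one would then put its smaller variable under both. *)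
Lemma hit_below_disjoint u v :
  (forall x, le x u -> ~~ le x v) ->
  (forall x y, ec x y -> le x u -> ~~ le y v) ->
  (forall x y, ec x y -> le y u -> ~~ le x v) ->
  (forall x y, tp x y -> le x y) ->
  forall e, ~~ (hit touch (below u) e && hit touch (below v) e).
Proof.
move=> dis ec1 ec2 tp_le [x y].
apply/negP => /andP[] /andP[/= txy hu] /andP[_ /=].
have disl l : l \in below u -> l \in below v -> False.
  case: l => l; rewrite !inE; first by move=> /dis/negPf->.
  by case/andP=> /dis/negPf->.
case/orP: hu => hu /orP[] hv; try by apply: disl hu hv.
  have nxy : x != y by apply: contraTneq hu => ->; apply/negP => /disl; apply.
  move: txy hu hv; rewrite /touch (negPf nxy) /=.
  case: x {nxy} => x; case: y => y //.
    by rewrite !inE => /ec1 h /h /negPf->.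
  rewrite !inE => /tp_le xy xu /andP[yv _].
  by have := dis _ xu; rewrite (le_trans xy yv).
have nxy : x != y by apply: contraTneq hu => <-; apply/negP => /disl; apply.
move: txy hu hv; rewrite /touch (negPf nxy) /=.
case: x {nxy} => x; case: y => y //.
  by rewrite !inE => /ec2 h /h /negPf->.
rewrite !inE => /tp_le xy /andP[yu _] xv.
by have := dis _ (le_trans xy yu); rewrite xv.
Qed.

End Forest.

From mathcomp Require Import all_classical all_reals all_analysis.
Import numFieldNormedType.Exports.
Local Open Scope classical_set_scope.

(** * Polyhedra in R^4 *)

Section Polyhedra.

Variable R : realType.

Definition point_of (x : 'rV[R]_4) : point4 R :=
  Point4 (x ord0 (inord 0)) (x ord0 (inord 1))
        (x ord0 (inord 2)) (x ord0 (inord 3)).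

Definition row_of (q : point4 R) : 'rV[R]_4 :=
  \row_i nth 0 [:: cX q; cA q; cB q; cC q] i.

Lemma row_ofK : cancel row_of point_of.
Proof. by case=> x a b c; rewrite /point_of !mxE !inordK. Qed.

Lemma value_continuous f : continuous (fun x => value f (point_of x)).
Proof.
move=> x; have term (k : R) i :
    (fun y : 'rV[R]_4 => k * y ord0 i : R) @ nbhs x --> (k * x ord0 i : R).
  apply: cvgM; first exact: cvg_cst.
  exact: coord_continuous.
have cst : (fun=> k0 f : R) @ nbhs x --> (k0 f : R) by exact: cvg_cst.
exact: cvgD (cvgD (cvgD (cvgD cst (term _ _)) (term _ _)) (term _ _)) (term _ _).
Qed.

Lemma value_segment f (x y : 'rV[R]_4) t :
  value f (point_of (x + t *: (y - x))) =
  (1 - t) * value f (point_of x) + t * value f (point_of y).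
Proof. by rewrite /value /= !mxE; ring. Qed.

Lemma segment_cvg (x y : 'rV[R]_4) :
  (fun t : R => x + t *: (y - x)) @ 0^'+ --> x.
Proof.
suff : (fun t : R => x + t *: (y - x)) @ 0^'+ --> x + 0 *: (y - x).
  by rewrite scale0r addr0.
apply: cvg_at_right_filter; apply: cvgD; first exact: cvg_cst.
by apply: cvgZr_tmp; exact: cvg_id.
Qed.

Variables (J : finType) (P : pred J) (g : J -> affine4 R) (c : J -> R).

Let polyhedron := [set x | weakly P g c (point_of x)].

Lemma strictly_interior x : strictly P g c (point_of x) -> polyhedron° x.
Proof.
move=> xP; rewrite /interior /=.
have : \forall y \near x, forall j, P j -> c j < value (g j) (point_of y).
  apply: (@filter_forall _ J
    (fun j y => P j -> c j < value (g j) (point_of y)) (nbhs x)) => j.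
  have [Pj | nPj] := boolP (P j); last first.
    by apply: filterE.
  have /(cvgr_gt (value (g j) (point_of x))) := @value_continuous (g j) x.
  by move=> /(_ (c j) (xP j Pj)); apply: filterS => y h _.
by apply: filterS => y h j Pj; apply/ltW/h.
Qed.

Lemma polyhedron_convex : convex_set polyhedron.
Proof.
move=> x y l; rewrite !inE => xP yP j Pj.
have -> : conv l x y = y + l%:num *: (x - y) :> 'rV[R]_4.
  by rewrite /conv /= /unstable.onem scalerBl scale1r scalerBr addrCA.
rewrite value_segment; have := xP j Pj; have := yP j Pj.
rewrite -subr_ge0 => hy; rewrite -subr_ge0 => hx; rewrite -subr_ge0.
rewrite (_ : _ - _ = (1 - l%:num) * (value (g j) (point_of y) - c j)
  + l%:num * (value (g j) (point_of x) - c j)); last by ring.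
by rewrite addr_ge0 // mulr_ge0 // subr_ge0.
Qed.

Lemma polyhedron_closed : closed polyhedron.
Proof.
have -> : polyhedron =
    \bigcap_(j in [set j | P j])
      ((fun x => value (g j) (point_of x)) @^-1` [set y | c j <= y]).
  by apply/seteqP; split=> x xP j Pj; apply: xP.
apply: closed_bigI => j _; apply: closed_comp; last exact: closed_ge.
by move=> x _; apply: value_continuous.
Qed.

(** Moving any point of the polyhedron slightly towards [z] makes all inequalities strict, so it is
    a limit of interior points. *)
Lemma polyhedron_region z : strictly P g c (point_of z) -> region polyhedron.
Proof.
move=> zP; split.
  by exists z => j Pj; apply/ltW/zP.
apply/seteqP; split.
  have /closure_id cE := polyhedron_closed.
  by rewrite [X in _ `<=` X]cE; apply: closure_subset; apply: interior_subset.
move=> x xP B /(@segment_cvg x z) Bt.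
have [t [Bx t0 t1]] : exists t : R,
    [/\ B (x + t *: (z - x)), 0 < t & t <= 1].
  near (0 : R)^'+ => t; exists t; split; first by near: t.
    by near: t; apply: nbhs_right_gt.
  by near: t; apply: nbhs_right_le.
exists (x + t *: (z - x)); split=> //; apply: strictly_interior => j Pj.
rewrite value_segment; have := zP j Pj; have := xP j Pj.
rewrite -subr_ge0 => h1; rewrite -subr_gt0 => h2; rewrite -subr_gt0.
rewrite (_ : _ - _ = (1 - t) * (value (g j) (point_of x) - c j)
  + t * (value (g j) (point_of z) - c j)); last by ring.
by apply: ltr_wpDl; [apply: mulr_ge0 => //; rewrite subr_ge0 | apply: mulr_gt0].
Unshelve. all: by end_near.
Qed.

End Polyhedra.

(** Near a common interior point [f] would vanish, yet it becomes positive on moving towards [z]. *)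
Lemma separated_interiors (R : realType) (A B : set 'rV[R]_4) f z :
  (forall x, A x -> 0 <= value f (point_of x)) ->
  (forall x, B x -> value f (point_of x) <= 0) ->
  0 < value f (point_of z) -> A° `&` B° = set0.
Proof.
move=> fA fB fz; apply/seteqP; split=> // x [Ax Bx].
have /(@segment_cvg R x z) ABx : nbhs x (A `&` B) by apply: filterI.
have [t [ABt t0]] : exists t : R,
    (A `&` B) (x + t *: (z - x)) /\ 0 < t.
  near (0 : R)^'+ => t; exists t; split; last first.
    by near: t; apply: nbhs_right_gt.
  by near: t; exact: ABx.
have f0 y : (A `&` B) y -> value f (point_of y) = 0.
  by move=> [/fA fy /fB fy']; apply/eqP; rewrite eq_le fy' fy.
have := f0 _ ABt; rewrite value_segment f0; last first.
  by split; apply: interior_subset.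
by move=> /eqP; rewrite mulr0 add0r gt_eqF // mulr_gt0.
Unshelve. all: by end_near.
Qed.

(** * Convex realization *)

Definition basic : set rcc8 :=
  [set r | r = EC \/ r = DC \/ r = TPP \/ r = TPPi \/ r = NTPP \/ r = NTPPi].

Lemma region_interior (T : topologicalType) (A : set T) :
  region A -> A° !=set0.
Proof.
move=> [[x Ax] cA]; rewrite -cA in Ax.
by have [y [Ay _]] := Ax setT filterT; exists y.
Qed.

Lemma open_meets_interior (T : topologicalType) (U A : set T) :
  open U -> region A -> U `&` A !=set0 -> U `&` A° !=set0.
Proof.
move=> oU [_ cA] [x [Ux Ax]]; rewrite -cA in Ax.
by have [y [Ay Uy]] := Ax U (open_nbhs_nbhs (conj oU Ux)); exists y.
Qed.

(** With [PO] excluded, two regions cannot cross; this is what makes inclusion a forest. *)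
Lemma basic_trichotomy (T : topologicalType) (A B : set T) r :
  region A -> region B -> basic r -> rcc8_holds r A B ->
  [\/ A `<` B, B `<` A | A° `&` B° = set0].
Proof.
have sub (C D : set T) : C `<` D° -> C `<` D.
  move=> [CD DC]; split; first exact: subset_trans CD (@interior_subset _ _).
  by move=> DC'; apply: DC; apply: subset_trans DC'; apply: interior_subset.
move=> rA rB [|[|[|[|[|]]]]] -> /=.
- by case=> _; constructor 3.
- move=> AB; constructor 3; apply/seteqP; split=> // x [].
  by move=> /interior_subset Ax /interior_subset Bx; rewrite -AB.
- by case; constructor 1.
- by case; constructor 2.
- by move/sub; constructor 1.
- by move/sub; constructor 2.
Qed.

Lemma basic_converse (T : topologicalType) (A B : set T) r :
  basic r -> rcc8_holds r A B -> exists2 r', basic r' & rcc8_holds r' B A.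
Proof.
rewrite /basic /= => - [|[|[|[|[|]]]]] -> /= h;
  [exists EC | exists DC | exists TPPi | exists TPP | exists NTPPi | exists NTPP];
  by [tauto | rewrite /= ?(setIC B) | rewrite /= ?(setIC B°) ?(setIC B)].
Qed.

(** The given regions enter only through the relations [le], [ec] and [tp] that they induce, so they
    may live in any topological space. *)
Theorem convex_realization (R : realType) (V : finType) (T : topologicalType)
    (S0 : V -> set T) :
  (forall v, region (S0 v)) ->
  (forall u v, u <> v -> exists2 r, basic r & rcc8_holds r (S0 u) (S0 v)) ->
  exists S : V -> set 'rV[R]_4,
    [/\ forall v, region (S v), forall v, convex_set (S v) &
     forall u v r, basic r -> rcc8_holds r (S0 u) (S0 v) ->
       rcc8_holds r (S u) (S v)].
Proof.
move=> reg0 rel0.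
have [v0 _ | V0] := pickP (@predT V); last first.
  by exists (fun=> setT); split=> v; have := V0 v.
pose le : rel V := fun u v => `[< S0 u `<=` S0 v >].
pose ec : rel V := fun u v => `[< rcc8_holds EC (S0 u) (S0 v) >].
pose tp : rel V := fun u v => `[< rel_TPP (S0 u) (S0 v) >].
have int_neq0 v := region_interior (reg0 v).
have not_apart u v w : S0 u `<=` S0 v -> S0 u `<=` S0 w ->
    (S0 v)° `&` (S0 w)° = set0 -> False.
  move=> uv uw vw; have [x ux] := int_neq0 u.
  by rewrite -[False]/(set0 x) -vw; split; apply: interiorS ux.
have tri u v : u <> v ->
    [\/ S0 u `<` S0 v, S0 v `<` S0 u | (S0 u)° `&` (S0 v)° = set0].
  by move=> /rel0[r br hr]; apply: basic_trichotomy br hr.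
have le_refl : reflexive le by move=> v; apply/asboolP.
have le_trans : transitive le.
  by move=> v u w /asboolP uv /asboolP vw; apply/asboolP; apply: subset_trans vw.
have le_anti : antisymmetric le.
  move=> u v /andP[/asboolP uv /asboolP vu]; apply/eqP/negPn/negP => /eqP /tri.
  by case=> [[]|[]|/(not_apart u)]//; apply.
have le_forest x u v : le x u -> le x v -> le u v || le v u.
  move=> /asboolP xu /asboolP xv; have [-> | /eqP /tri] := eqVneq u v.
    by rewrite le_refl.
  case=> [[uv _] | [vu _] | /(not_apart _ _ _ xu xv)//].
    by apply/orP; left; apply/asboolP.
  by apply/orP; right; apply/asboolP.
have apart u v : ~~ le u v -> ~~ le v u -> (S0 u)° `&` (S0 v)° = set0.
  move=> nuv nvu; case: (tri u v) => //.
  - by move=> uv; rewrite uv le_refl in nuv.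
  - by move=> [uv _]; case/asboolP: nuv.
  - by move=> [vu _]; case/asboolP: nvu.
have tp_le x y : tp x y -> le x y by move=> /asboolP[[xy _] _]; apply/asboolP.
pose D := below le.
have FD v : D v \in forest_family le by apply: below_forest_family.
have F1 l : [set l]%SET \in forest_family le by apply: set1_forest_family.
have [p [J [g [P [c [cell_hit cell_own cellS cell_nt cell_sep]]]]]] :=
  laminar_cells R (inl v0) (forest_family_laminar le_trans le_anti le_forest)
    (set0_forest_family le_refl) (@touch_refl V ec tp).
pose cell a : set 'rV[R]_4 := [set x | weakly (P a) g (c a) (point_of x)].
have hit_cell a e : hit (touch ec tp) a e -> cell a (row_of (p e)).
  by move=> ae; rewrite /cell /= row_ofK; apply: cell_hit.
have own_cell (a : {set leaf V}) x : x \in a -> (cell a)° (row_of (p (x, x))).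
  by move=> ax; apply: strictly_interior; rewrite row_ofK; apply: cell_own.
have cell_sub (a b : {set leaf V}) : a \subset b -> cell a `<=` cell b.
  by move=> ab x; apply: cellS.
have cell_region (a : {set leaf V}) x : x \in a -> region (cell a).
  move=> ax; apply: (@polyhedron_region _ _ _ _ _ (row_of (p (x, x)))).
  by rewrite row_ofK; apply: cell_own.
have own_D v : inl v \in D v by rewrite inE.
have cell_int (a b : {set leaf V}) : a \in forest_family le ->
    b \in forest_family le -> [disjoint a & b]%B ->
    (cell a)° `&` (cell b)° = set0.
  move=> Fa Fb dis; have [[f [fa fb fpos]] _] := cell_sep a b Fa Fb dis.
  have [x ax] : exists x, x \in a.
    by apply/set0Pn; apply: contraNneq (set0_forest_family le_refl) => <-.
  apply: (@separated_interiors R _ _ f (row_of (p (x, x)))).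
  - by move=> y; apply: fa.
  - by move=> y; apply: fb.
  - by rewrite row_ofK; apply: fpos.
have own_out (a b : {set leaf V}) x : a \in forest_family le ->
    b \in forest_family le -> [disjoint a & b]%B -> x \in a ->
    ~ cell b (row_of (p (x, x))).
  move=> Fa Fb dis ax; have [[f [_ fb fpos]] _] := cell_sep a b Fa Fb dis.
  rewrite /cell /= row_ofK => /fb; apply/negP; rewrite -ltNge; exact: fpos.
have proper u v : S0 u `<` S0 v ->
    [/\ le u v, u != v & ~ cell (D u) (row_of (p (inl v, inl v)))].
  move=> [uv nvu]; have nuv : u != v by apply: contra_notN nvu => /eqP->.
  split=> //; first exact/asboolP.
  apply: (own_out [set inl v]%SET (D u) (inl v) (F1 _) (FD u)); last first.
    by rewrite inE.
  by rewrite disjoints1 inE; apply/negP => /asboolP.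
have tpp_cell u v : rel_TPP (S0 u) (S0 v) -> rel_TPP (cell (D u)) (cell (D v)).
  move=> uv; have [luv nuv out] := proper u v uv.1; split.
    split; first by apply/cell_sub/belowS.
    by move=> /(_ _ (interior_subset (own_cell _ _ (own_D v)))).
  (* The point of this contact lies in the cells of u and of the outer neighbour of v. Were it
     interior to the cell of v, that neighbour, being regular, would share interior points with
     v. *)
  pose e : leaf V * leaf V := (inl u, inr v).
  have te : touch ec tp e.1 e.2 by rewrite /touch /=; apply/asboolP.
  move=> [/(_ (row_of (p e))) sub _].
  have De : cell (D u) (row_of (p e)) by apply: hit_cell; rewrite /hit te own_D.
  have Se : cell [set inr v]%SET (row_of (p e)).
    by apply: hit_cell; rewrite /hit te /= set11 orbT.
  have [x [Dx Sx]] := open_meets_interior (@open_interior _ (cell (D v)))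
    (cell_region [set inr v]%SET (inr v) (set11 _))
    (ex_intro _ _ (conj (sub De) Se)).
  rewrite -[False]/(set0 x) -(cell_int (D v) [set inr v]%SET) //.
  by rewrite disjoint_sym disjoints1 inE eqxx andbF.
have ntpp_cell u v : rel_NTPP (S0 u) (S0 v) ->
    rel_NTPP (cell (D u)) (cell (D v)).
  move=> [uv nvu].
  have ltuv : S0 u `<` S0 v.
    split; first exact: subset_trans uv (@interior_subset _ _).
    by move=> vu; apply: nvu; apply: subset_trans vu; apply: interior_subset.
  have [luv nuv out] := proper u v ltuv; split; last first.
    by move=> /(_ _ (own_cell _ _ (own_D v))).
  (* If y is not inside v, either y contains v and hence x, or y has its interior apart from v
     although it meets the interior of v; both are impossible. *)
  have ec1 x y : ec x y -> le x u -> le y v.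
    move=> /asboolP[[z [xz yz]] xy] /asboolP xu; apply/negPn/negP => nyv.
    have [/asboolP vy | nvy] := boolP (le v y).
      apply: (not_apart x x y) xy => //.
      exact: subset_trans xu (subset_trans ltuv.1 vy).
    have [t] := open_meets_interior (@open_interior _ (S0 v)) (reg0 y)
      (ex_intro _ z (conj (uv _ (xu _ xz)) yz)).
    by rewrite apart.
  have ec2 x y : ec x y -> le y u -> le x v.
    move=> /asboolP[xy0 xy]; apply: ec1; apply/asboolP.
    by split; rewrite setIC.
  (* Both y and v contain x, so they are comparable; v inside y would put x in the interior of y,
     against tangency. *)
  have tp1 x y : tp x y -> le x u -> le y v && (y != v).
    move=> txy xu; have ly := le_trans _ _ _ xu luv.
    have nvy : ~~ le v y.
      apply/negP => /asboolP vy; move/asboolP: txy => [[_ nyx]]; apply.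
      split.
        have /asboolP sxu := xu.
        exact: subset_trans sxu (subset_trans uv (interiorS vy)).
      (* If x contained the interior of y, it would contain its closure y. *)
      move=> yx; apply: nyx; rewrite -(reg0 y).2.
      have /closure_id -> : closed (S0 x).
        by rewrite -(reg0 x).2; exact: closed_closure.
      exact: closure_subset.
    have /orP[-> | ] := le_forest _ _ _ (tp_le _ _ txy) ly.
      by apply: contraNneq nvy => ->.
    by rewrite (negPf nvy).
  have sub : D u \proper D v.
    rewrite properE belowS //=; apply/subsetPn; exists (inl v) => //.
    by rewrite inE; apply/negP => /asboolP; case: ltuv.
  have nt := hit_below_inside le_trans le_anti luv nuv ec1 ec2 tp_le tp1.
  move=> x Dx; apply: strictly_interior; apply: cell_nt sub nt Dx.
(* No basic relation is reflexive, so only distinct u and v remain. *)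
have irr u r : basic r -> ~ rcc8_holds r (S0 u) (S0 u).
  have [x ux] := int_neq0 u.
  have nsub : ~ (S0 u `<` (S0 u)°) by move=> [_]; apply; apply: interior_subset.
  move=> [|[|[|[|[|]]]]] -> //=.
  - by move=> [_]; rewrite setIid => u0; rewrite u0 in ux.
  - by rewrite setIid => u0; rewrite u0 interior0 in ux.
  - by move=> [[_ +] _]; apply.
  - by move=> [[_ +] _]; apply.
have incomp u v : u <> v -> (S0 u)° `&` (S0 v)° = set0 ->
    ~~ le u v /\ ~~ le v u.
  move=> nuv dis; split; apply/negP => /asboolP h.
    exact: (not_apart _ _ _ (@subset_refl _ _) h dis).
  exact: (not_apart _ _ _ h (@subset_refl _ _) dis).
exists (fun v => cell (D v)); split=> [v | v | u v r br hr].
- exact: cell_region (own_D v).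
- exact: polyhedron_convex.
have nuv : u <> v by move=> uv; rewrite uv in hr; apply: irr br hr.
case: br hr => [|[|[|[|[|]]]]] -> /=.
- move=> [uv0 dis]; have [nle nge] := incomp u v nuv dis; split.
    exists (row_of (p (inl u, inl v))).
    have te : touch ec tp (inl u) (inl v).
      by rewrite /touch /=; apply/orP; right; apply/asboolP.
    by split; apply: hit_cell; rewrite /hit te /= own_D ?orbT.
  by apply: cell_int => //; apply: disjoint_below.
- move=> dis.
  have [nle nge] : ~~ le u v /\ ~~ le v u.
    apply: incomp => //; apply/seteqP; split=> // x [].
    by move=> /interior_subset ux /interior_subset vx; rewrite -dis.
  have no w z x : le w u -> le z v -> S0 w x -> S0 z x -> False.
    move=> /asboolP wu /asboolP zv wx zx; rewrite -[False]/(set0 x) -dis.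
    by split; [apply: wu | apply: zv].
  have [_ sep] := cell_sep _ _ (FD u) (FD v) (disjoint_below le_forest nle nge).
  apply/seteqP; split=> // x [ux vx].
  apply: (sep _ _ ux vx); apply: hit_below_disjoint => //.
  + move=> w wu; apply/negP => wv; have [[y yw] _] := reg0 w.
    exact: (no _ _ _ wu wv yw yw).
  + move=> w z /asboolP[[y [yw yz]] _] wu; apply/negP => zv.
    exact: (no _ _ _ wu zv yw yz).
  + move=> w z /asboolP[[y [yw yz]] _] zu; apply/negP => wv.
    exact: (no _ _ _ zu wv yz yw).
- exact: tpp_cell.
- exact: tpp_cell.
- exact: ntpp_cell.
- exact: ntpp_cell.
Qed.

Theorem proposition17 (R : realType) (V : finType) (N : network V) :
  atomic N ->
  network_over [set r | r = EC \/ r = DC \/ r = TPP \/ r = TPPi \/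
                        r = NTPP \/ r = NTPPi] N ->
  consistent R N ->
  exists S : V -> set 'rV[R]_4, convex_solution N S.
Proof.
move=> atN overN [n [_ [S0 [reg0 sol0]]]].
have [u v nuv | S [regS convS relS]] :=
    @convex_realization R V ('rV[R]_n : topologicalType) S0 reg0.
  (* Atomicity provides a constraint in one of the two orientations; the second is reversed by
     [basic_converse]. *)
  have [c Nc [[cu cv _] | [cv cu _]]] := atN u v nuv;
    have [r cr hr] := sol0 c Nc; rewrite cu cv in hr.
    by exists r => //; apply: overN cr.
  by apply: basic_converse hr; apply: overN cr.
exists S; split=> //; split=> // c Nc.
have [r cr hr] := sol0 c Nc; exists r => //.
by apply: relS hr; apply: overN cr.
Qed.
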